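(* In the simplified concurrent algorithm described in the context, a conflict between a non-blocking non-spanning edge addition and a concurrent spanning edge removal that results in an edge recorded as non-spanning whose endpoints lie in different connected components of the maintained spanning forest is impossible.
   Context: Setting: a concurrent dynamic connectivity structure maintaining a spanning forest $F$ of an undirected graph via Euler Tour Trees, with a non-blocking query \texttt{connected(u, v)} (linearizable). Simplifying assumptions: all spanning-forest updates are done under one global lock (\texttt{blocking\_add\_edge}, \texttt{blocking\_remove\_edge}); all non-spanning edges are kept in one global concurrent multiset \texttt{non\_spanning\_edges}; threads never add the same edge concurrently. Each edge has a status in $\{\texttt{INITIAL}, \texttt{SPANNING}, \texttt{NON-SPANNING}, \texttt{REMOVED}\}$, initially \texttt{INITIAL}. A blocking removal of a spanning edge publishes a descriptor in a global field \texttt{remove\_op} with a slot \texttt{replacement} (initially \texttt{null}), then searches \texttt{non\_spanning\_edges} for a replacement edge (an edge reconnecting the two trees); while searching, any edge seen in status \texttt{INITIAL} is helped to be added (as replacement if suitable, otherwise as non-spanning if its endpoints are connected); it also uses any edge installed in its \texttt{replacement} slot; at the end it sets the slot to a value \texttt{DONE}, and if no replacement was found the tree is split. Non-blocking \texttt{add\_edge(e)}: (1) if $\texttt{connected}(e.u,e.v)$ is false, perform \texttt{blocking\_add\_edge(e)} and return; (2) insert $e$ into \texttt{non\_spanning\_edges}; (3) read \texttt{op := remove\_op}; if \texttt{op} is non-null and $e$ can be a replacement for \texttt{op}: if CAS(\texttt{op.replacement}, \texttt{null}, $e$) succeeds, remove $e$ from the multiset, CAS the status from \texttt{INITIAL}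 to \texttt{SPANNING}, and return; else if \texttt{op.replacement} $=$ \texttt{DONE}, remove $e$ from the multiset, perform \texttt{blocking\_add\_edge(e)} and return; (4) if $\texttt{connected}(e.u,e.v)$ is false, remove $e$ from the multiset and restart from (1); (5) if CAS(status, \texttt{INITIAL}, \texttt{NON-SPANNING}) succeeds return; otherwise (a concurrent writer used or helped add $e$) remove one copy of $e$ from the multiset and return. Non-blocking \texttt{remove\_edge(e)}: if status is \texttt{NON-SPANNING}, CAS it to \texttt{REMOVED} (restart on failure) and then delete $e$ from the multiset; if \texttt{SPANNING}, do \texttt{blocking\_remove\_edge}; if \texttt{REMOVED} or \texttt{INITIAL}, return. *)

(* Defs.v *)
From mathcomp Require Import all_boot.

Set Implicit Arguments.
Unset Strict Implicit.
Unset Printing Implicit Defensive.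

(* Interleaving semantics of the algorithm.  [V] is the set of vertices, [T]  *)
(* the set of threads and [E] the set of edge records: every call of          *)
(* [add_edge] works on a new record, whose endpoints are given by             *)
(* [ends : E -> V * V].  Adding again an edge that was removed is the         *)
(* addition of another record with the same endpoints.  Every access to a     *)
(* shared object is one atomic step.                                          *)

Inductive edge_status := INITIAL | SPANNING | NON_SPANNING | REMOVED.

Inductive slot (E : Type) := Null | Installed of E | Done.
Arguments Null {E}.
Arguments Done {E}.

(* The mutable field [replacement] of a descriptor is stored in the shared    *)
(* memory under the key [op_id].  [op_rest] is the spanning forest without    *)
(* the edge being removed; the trees of its two endpoints in [op_rest] are    *)
(* the two trees that a replacement has to reconnect.                         *)
Record descriptor (E : Type) := Descriptor {
  op_id : nat;
  op_edge : E;
  op_rest : seq E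
}.

Section Graph.
Context {V : finType} {E : eqType}.
Implicit Types (ends : E -> V * V) (F : seq E) (e : E).

Definition same_edge ends e1 e2 : bool :=
  (ends e1 == ends e2) || (ends e1 == ((ends e2).2, (ends e2).1)).

Definition adjacent ends F : rel V :=
  [rel x y | has (fun e => (ends e == (x, y)) || (ends e == (y, x))) F].

Definition joined ends F (x y : V) : bool := connect (adjacent ends F) x y.

Definition ends_joined ends F e : bool := joined ends F (ends e).1 (ends e).2.

Definition can_replace ends (op : descriptor E) e : bool :=
  let: (a, b) := ends (op_edge op) in
  let: (x, y) := ends e in
  let R := joined ends (op_rest op) in
  (R x a && R y b) || (R x b && R y a).

End Graph.

(* [forest] is the spanning forest that [connected] queries.  During a        *)
(* blocking removal it keeps the removed edge until the search has ended;     *)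
(* then that edge is exchanged for the replacement, or the tree is split.     *)
(* The sequence [non_spanning_edges] represents a multiset.                   *)
Record shared (E : eqType) (T : Type) := Shared {
  status_of : E -> edge_status;
  forest : seq E;
  non_spanning_edges : seq E;
  remove_op : option (descriptor E);
  replacement : nat -> slot E;
  next_op : nat;
  lock : option T
}.

Section Updates.
Context {E : eqType} {T : Type}.
Implicit Type m : shared E T.

Definition set_status m e st := Shared
  [eta status_of m with e |-> st] (forest m) (non_spanning_edges m)
  (remove_op m) (replacement m) (next_op m) (lock m).

Definition set_forest m F := Shared
  (status_of m) F (non_spanning_edges m)
  (remove_op m) (replacement m) (next_op m) (lock m).

Definition insert m e := Shared
  (status_of m) (forest m) (e :: non_spanning_edges m)
  (remove_op m) (replacement m) (next_op m) (lock m).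

Definition delete m e := Shared
  (status_of m) (forest m) (rem e (non_spanning_edges m))
  (remove_op m) (replacement m) (next_op m) (lock m).

Definition set_replacement m (op : descriptor E) x := Shared
  (status_of m) (forest m) (non_spanning_edges m)
  (remove_op m) [eta replacement m with op_id op |-> x] (next_op m) (lock m).

Definition publish m (op : descriptor E) := Shared
  (status_of m) (forest m) (non_spanning_edges m)
  (Some op) [eta replacement m with op_id op |-> Null] (next_op m).+1 (lock m).

Definition clear_op m := Shared
  (status_of m) (forest m) (non_spanning_edges m)
  None (replacement m) (next_op m) (lock m).

Definition set_lock m (l : option T) := Shared
  (status_of m) (forest m) (non_spanning_edges m)
  (remove_op m) (replacement m) (next_op m) l.

Definition new_op m e := Descriptor
  (next_op m) e [seq f <- forest m | f != e].

End Updates.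

(* Program counters, with the local variables live at that point.  In the     *)
(* search, [todo] contains the edges that the iterator still has to visit.    *)
Inductive pc (E : Type) :=
| Idle
| AddTest of E
| AddInsert of E
| AddReadOp of E
| AddOffer of E & descriptor E
| AddWonDelete of E
| AddWonMark of E
| AddReadSlot of E & descriptor E
| AddLateDelete of E
| AddRetest of E
| AddRestartDelete of E
| AddMark of E
| AddAidedDelete of E
| BAddLock of E
| BAddReadStatus of E
| BAddTest of E
| BAddInsert of E
| BAddMarkNonSpanning of E
| BAddLink of E
| BAddMarkSpanning of E
| BAddUnlock of E
| RemReadStatus of E
| RemMark of E
| RemDelete of E
| BRemLock of E
| BRemReadStatus of E
| BRemPublish of E
| BRemScanStart of descriptor E
| BRemScan of descriptor E & seq E
| BRemVisit of descriptor E & seq E & E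
| BRemClose of descriptor E & seq E & E & edge_status
| BRemClaim of descriptor E & seq E & E & edge_status
| BRemAidTest of descriptor E & seq E & E
| BRemAidInsert of descriptor E & seq E & E
| BRemAidMark of descriptor E & seq E & E
| BRemAidDelete of descriptor E & seq E & E
| BRemFinish of descriptor E
| BRemUse of descriptor E & E
| BRemUseMark of descriptor E & E & edge_status
| BRemUseDelete of descriptor E & E
| BRemUpdate of descriptor E & option E
| BRemMark of descriptor E
| BRemClear of descriptor E
| BRemUnlock.
Arguments Idle {E}.
Arguments BRemUnlock {E}.

Definition adding (E : Type) (p : pc E) : option E :=
  match p with
  | AddTest e | AddInsert e | AddReadOp e | AddOffer e _
  | AddWonDelete e | AddWonMark e | AddReadSlot e _ | AddLateDelete e
  | AddRetest e | AddRestartDelete e | AddMark e | AddAidedDelete e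
  | BAddLock e | BAddReadStatus e | BAddTest e | BAddInsert e
  | BAddMarkNonSpanning e | BAddLink e | BAddMarkSpanning e | BAddUnlock e =>
      Some e
  | _ => None
  end.

(* A non-spanning edge turned into a replacement leaves the multiset; the     *)
(* copy of an edge in status INITIAL belongs to the thread that adds it.      *)
Definition after_claim (E : Type) (op : descriptor E) (r : E)
    (st : edge_status) : pc E :=
  if st is NON_SPANNING then BRemUseDelete op r else BRemUpdate op (Some r).

Section Semantics.
Context {V : finType} {E : eqType} {T : Type}.
Context (ends : E -> V * V).
Implicit Types (m : shared E T) (op : descriptor E) (todo : seq E) (e r : E).

(* [add_edge]; a compare-and-set gives one rule for success, one for failure. *)
Inductive add_step : pc E -> shared E T -> pc E -> shared E T -> Prop :=
| add_test_connected e m : ends_joined ends (forest m) e ->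
    add_step (AddTest e) m (AddInsert e) m
| add_test_disconnected e m : ~~ ends_joined ends (forest m) e ->
    add_step (AddTest e) m (BAddLock e) m
| add_insert e m :
    add_step (AddInsert e) m (AddReadOp e) (insert m e)
| add_op_null e m : remove_op m = None ->
    add_step (AddReadOp e) m (AddRetest e) m
| add_op_unsuitable e op m : remove_op m = Some op -> ~~ can_replace ends op e ->
    add_step (AddReadOp e) m (AddRetest e) m
| add_op_suitable e op m : remove_op m = Some op -> can_replace ends op e ->
    add_step (AddReadOp e) m (AddOffer e op) m
| add_offer_won e op m : replacement m (op_id op) = Null ->
    add_step (AddOffer e op) m
             (AddWonDelete e) (set_replacement m op (Installed e))
| add_offer_lost e op m : replacement m (op_id op) <> Null ->
    add_step (AddOffer e op) m (AddReadSlot e op) m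
| add_won_delete e m :
    add_step (AddWonDelete e) m (AddWonMark e) (delete m e)
| add_won_mark e m : status_of m e = INITIAL ->
    add_step (AddWonMark e) m Idle (set_status m e SPANNING)
| add_won_marked e m : status_of m e <> INITIAL ->
    add_step (AddWonMark e) m Idle m
| add_slot_done e op m : replacement m (op_id op) = Done ->
    add_step (AddReadSlot e op) m (AddLateDelete e) m
| add_slot_used e op m : replacement m (op_id op) <> Done ->
    add_step (AddReadSlot e op) m (AddRetest e) m
| add_late_delete e m :
    add_step (AddLateDelete e) m (BAddLock e) (delete m e)
| add_retest_connected e m : ends_joined ends (forest m) e ->
    add_step (AddRetest e) m (AddMark e) m
| add_retest_disconnected e m : ~~ ends_joined ends (forest m) e ->
    add_step (AddRetest e) m (AddRestartDelete e) m
| add_restart e m :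
    add_step (AddRestartDelete e) m (AddTest e) (delete m e)
| add_mark e m : status_of m e = INITIAL ->
    add_step (AddMark e) m Idle (set_status m e NON_SPANNING)
| add_helped e m : status_of m e <> INITIAL ->
    add_step (AddMark e) m (AddAidedDelete e) m
| add_helped_delete e m :
    add_step (AddAidedDelete e) m Idle (delete m e).

(* A concurrent writer may have helped to add the edge before the lock is     *)
(* taken; then the status is not INITIAL any more and nothing is left to do.  *)
Inductive blocking_add_step (t : T) :
    pc E -> shared E T -> pc E -> shared E T -> Prop :=
| badd_lock e m : lock m = None ->
    blocking_add_step t (BAddLock e) m (BAddReadStatus e) (set_lock m (Some t))
| badd_initial e m : status_of m e = INITIAL ->
    blocking_add_step t (BAddReadStatus e) m (BAddTest e) m
| badd_helped e m : status_of m e <> INITIAL ->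
    blocking_add_step t (BAddReadStatus e) m (BAddUnlock e) m
| badd_connected e m : ends_joined ends (forest m) e ->
    blocking_add_step t (BAddTest e) m (BAddInsert e) m
| badd_disconnected e m : ~~ ends_joined ends (forest m) e ->
    blocking_add_step t (BAddTest e) m (BAddLink e) m
| badd_insert e m :
    blocking_add_step t (BAddInsert e) m (BAddMarkNonSpanning e) (insert m e)
| badd_mark_non_spanning e m :
    blocking_add_step t (BAddMarkNonSpanning e) m
                        (BAddUnlock e) (set_status m e NON_SPANNING)
| badd_link e m :
    blocking_add_step t (BAddLink e) m
                        (BAddMarkSpanning e) (set_forest m (e :: forest m))
| badd_mark_spanning e m :
    blocking_add_step t (BAddMarkSpanning e) m
                        (BAddUnlock e) (set_status m e SPANNING)
| badd_unlock e m :
    blocking_add_step t (BAddUnlock e) m Idle (set_lock m None).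

Inductive remove_step : pc E -> shared E T -> pc E -> shared E T -> Prop :=
| rem_non_spanning e m : status_of m e = NON_SPANNING ->
    remove_step (RemReadStatus e) m (RemMark e) m
| rem_spanning e m : status_of m e = SPANNING ->
    remove_step (RemReadStatus e) m (BRemLock e) m
| rem_absent e m : status_of m e = REMOVED \/ status_of m e = INITIAL ->
    remove_step (RemReadStatus e) m Idle m
| rem_mark e m : status_of m e = NON_SPANNING ->
    remove_step (RemMark e) m (RemDelete e) (set_status m e REMOVED)
| rem_restart e m : status_of m e <> NON_SPANNING ->
    remove_step (RemMark e) m (RemReadStatus e) m
| rem_delete e m :
    remove_step (RemDelete e) m Idle (delete m e).

(* The iterator over the concurrent multiset is weakly consistent: it has to  *)
(* visit an edge that is present during the whole search; it may or may not   *)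
(* visit an edge that is inserted or deleted meanwhile.                       *)
(* [BRemClose] and [BRemFinish] exchange the content of the slot for Done.    *)
(* An edge found there is the replacement.  Otherwise, [BRemClose] goes on to *)
(* claim the suitable edge at hand by a compare-and-set of its status.        *)
Inductive blocking_remove_step (t : T) :
    pc E -> shared E T -> pc E -> shared E T -> Prop :=
| brem_lock e m : lock m = None ->
    blocking_remove_step t (BRemLock e) m
                           (BRemReadStatus e) (set_lock m (Some t))
| brem_spanning e m : status_of m e = SPANNING ->
    blocking_remove_step t (BRemReadStatus e) m (BRemPublish e) m
| brem_absent e m : status_of m e <> SPANNING ->
    blocking_remove_step t (BRemReadStatus e) m BRemUnlock m
| brem_publish e m :
    blocking_remove_step t (BRemPublish e) m
      (BRemScanStart (new_op m e)) (publish m (new_op m e))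
| brem_scan_start op m :
    blocking_remove_step t (BRemScanStart op) m
                           (BRemScan op (non_spanning_edges m)) m
| brem_scan_visit op todo r m : r \in non_spanning_edges m ++ todo ->
    blocking_remove_step t (BRemScan op todo) m
      (BRemVisit op [seq f <- todo | f != r] r) m
| brem_scan_skip op todo r m : r \notin non_spanning_edges m ->
    blocking_remove_step t (BRemScan op todo) m
      (BRemScan op [seq f <- todo | f != r]) m
| brem_scan_installed op todo r m : replacement m (op_id op) = Installed r ->
    blocking_remove_step t (BRemScan op todo) m (BRemFinish op) m
| brem_scan_end op m :
    blocking_remove_step t (BRemScan op [::]) m (BRemFinish op) m
| brem_visit_suitable op todo r m :
    status_of m r = INITIAL \/ status_of m r = NON_SPANNING ->
    can_replace ends op r ->
    blocking_remove_step t (BRemVisit op todo r) m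
                           (BRemClose op todo r (status_of m r)) m
| brem_visit_aid op todo r m :
    status_of m r = INITIAL -> ~~ can_replace ends op r ->
    blocking_remove_step t (BRemVisit op todo r) m (BRemAidTest op todo r) m
| brem_visit_unsuitable op todo r m :
    status_of m r = NON_SPANNING -> ~~ can_replace ends op r ->
    blocking_remove_step t (BRemVisit op todo r) m (BRemScan op todo) m
| brem_visit_ignore op todo r m :
    status_of m r = SPANNING \/ status_of m r = REMOVED ->
    blocking_remove_step t (BRemVisit op todo r) m (BRemScan op todo) m
| brem_close_installed op todo r st e m :
    replacement m (op_id op) = Installed e ->
    blocking_remove_step t (BRemClose op todo r st) m
                           (BRemUse op e) (set_replacement m op Done)
| brem_close op todo r st m :
    replacement m (op_id op) = Null \/ replacement m (op_id op) = Done ->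
    blocking_remove_step t (BRemClose op todo r st) m
      (BRemClaim op todo r st) (set_replacement m op Done)
| brem_claim op todo r st m : status_of m r = st ->
    blocking_remove_step t (BRemClaim op todo r st) m
      (after_claim op r st) (set_status m r SPANNING)
| brem_claim_retry op todo r st m : status_of m r <> st ->
    blocking_remove_step t (BRemClaim op todo r st) m (BRemVisit op todo r) m
| brem_aid_connected op todo r m : ends_joined ends (forest m) r ->
    blocking_remove_step t (BRemAidTest op todo r) m
                           (BRemAidInsert op todo r) m
| brem_aid_disconnected op todo r m : ~~ ends_joined ends (forest m) r ->
    blocking_remove_step t (BRemAidTest op todo r) m (BRemScan op todo) m
| brem_aid_insert op todo r m :
    blocking_remove_step t (BRemAidInsert op todo r) m
                           (BRemAidMark op todo r) (insert m r)
| brem_aid_mark op todo r m : status_of m r = INITIAL ->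
    blocking_remove_step t (BRemAidMark op todo r) m
      (BRemScan op todo) (set_status m r NON_SPANNING)
| brem_aid_fail op todo r m : status_of m r <> INITIAL ->
    blocking_remove_step t (BRemAidMark op todo r) m
                           (BRemAidDelete op todo r) m
| brem_aid_delete op todo r m :
    blocking_remove_step t (BRemAidDelete op todo r) m
                           (BRemScan op todo) (delete m r)
| brem_finish_installed op e m : replacement m (op_id op) = Installed e ->
    blocking_remove_step t (BRemFinish op) m
                           (BRemUse op e) (set_replacement m op Done)
| brem_finish_none op m :
    replacement m (op_id op) = Null \/ replacement m (op_id op) = Done ->
    blocking_remove_step t (BRemFinish op) m
                           (BRemUpdate op None) (set_replacement m op Done)
| brem_use op e m : status_of m e = INITIAL \/ status_of m e = NON_SPANNING ->
    blocking_remove_step t (BRemUse op e) m (BRemUseMark op e (status_of m e)) m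
| brem_use_marked op e m : status_of m e = SPANNING \/ status_of m e = REMOVED ->
    blocking_remove_step t (BRemUse op e) m (BRemUpdate op (Some e)) m
| brem_use_mark op e st m : status_of m e = st ->
    blocking_remove_step t (BRemUseMark op e st) m
                           (after_claim op e st) (set_status m e SPANNING)
| brem_use_retry op e st m : status_of m e <> st ->
    blocking_remove_step t (BRemUseMark op e st) m (BRemUse op e) m
| brem_use_delete op e m :
    blocking_remove_step t (BRemUseDelete op e) m
                           (BRemUpdate op (Some e)) (delete m e)
| brem_replace op e m :
    blocking_remove_step t (BRemUpdate op (Some e)) m
      (BRemMark op)
      (set_forest m (e :: [seq f <- forest m | f != op_edge op]))
| brem_split op m :
    blocking_remove_step t (BRemUpdate op None) m
      (BRemMark op) (set_forest m [seq f <- forest m | f != op_edge op])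
| brem_mark op m :
    blocking_remove_step t (BRemMark op) m
                           (BRemClear op) (set_status m (op_edge op) REMOVED)
| brem_clear op m :
    blocking_remove_step t (BRemClear op) m BRemUnlock (clear_op m)
| brem_unlock m :
    blocking_remove_step t BRemUnlock m Idle (set_lock m None).

Definition thread_step (t : T) (p : pc E) m (p' : pc E) m' : Prop :=
  [\/ add_step p m p' m', blocking_add_step t p m p' m',
      remove_step p m p' m' | blocking_remove_step t p m p' m'].

End Semantics.

(* [added] contains the records on which [add_edge] was already called. *)
Record config (E T : eqType) := Config {
  memory : shared E T;
  pcs : T -> pc E;
  added : seq E
}.

Section Executions.
Context {V : finType} {E T : eqType}.
Context (ends : E -> V * V).
Implicit Type c : config E T.

Definition init_config : config E T :=
  Config (Shared (fun=> INITIAL) [::] [::] None (fun=> Null) 0 None)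
         (fun=> Idle) [::].

Inductive step c : config E T -> Prop :=
| call_add_edge t e :
    pcs c t = Idle -> e \notin added c ->
    (forall t' e', adding (pcs c t') = Some e' -> ~~ same_edge ends e' e) ->
    step c (Config (memory c) [eta pcs c with t |-> AddTest e] (e :: added c))
| call_remove_edge t e :
    pcs c t = Idle ->
    step c (Config (memory c) [eta pcs c with t |-> RemReadStatus e] (added c))
| run_thread t p' m' :
    thread_step ends t (pcs c t) (memory c) p' m' ->
    step c (Config m' [eta pcs c with t |-> p'] (added c)).

Inductive reachable : config E T -> Prop :=
| reachable_init : reachable init_config
| reachable_step c c' : reachable c -> step c c' -> reachable c'.

End Executions.

(* Main.v *)
(** The forest loses connectivity only when a removal splits a tree, so it
    suffices that at this moment no suitable edge is NON_SPANNING or about to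
    be marked so.  An adder past its read of [remove_op] (and of the slot) keeps
    its own copy of the edge in the multiset, and a NON_SPANNING record keeps one
    too; counting these copies shows that concurrent deletions never take the
    last one away.  Hence such an edge present when the scan starts is visited,
    and then claimed by the removal.  An adder that commits during the scan
    without being claimed has seen the slot filled by somebody else, and then
    the removal ends with a replacement, which keeps every connected pair
    connected. *)
Require Import Defs.
From mathcomp Require Import all_boot.

Set Implicit Arguments.
Unset Strict Implicit.
Unset Printing Implicit Defensive.

(** * Connectivity after deleting or exchanging one edge *)

Section ForestConnectivity.
Context {V : finType} {E : eqType}.
Implicit Types (ends : E -> V * V) (F : seq E) (op : descriptor E).

Lemma joined_sym ends F x y : joined ends F x y = joined ends F y x.
Proof.
apply: sym_connect_sym => {}x {}y /=.
by apply: eq_has => e; rewrite orbC.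
Qed.

Lemma joined_trans ends F : transitive (joined ends F).
Proof. exact: connect_trans. Qed.

Lemma joined_sub ends F F' x y :
  {subset F <= F'} -> joined ends F x y -> joined ends F' x y.
Proof.
move=> sFF'; apply: connect_sub => {}x {}y /= /hasP[e eF xye].
by apply: connect1; apply/hasP; exists e => //; apply: sFF'.
Qed.

Lemma joined_edge ends F e : e \in F -> joined ends F (ends e).1 (ends e).2.
Proof.
by move=> eF; apply: connect1; apply/hasP; exists e; rewrite // -surjective_pairing eqxx.
Qed.

(** Induction on the path: its first edge either survives, which keeps the case obtained for the
    tail, or is [f], which moves the start to the other endpoint of [f]. *)
Lemma joined_remove ends F f x y :
  let R := joined ends [seq g <- F | g != f] in
  joined ends F x y ->
  [\/ R x y, R x (ends f).1 && R y (ends f).2 | R x (ends f).2 && R y (ends f).1].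
Proof.
move=> R /connectP[p + ->] {y}.
have Rsym u v : R u v = R v u by exact: joined_sym.
have Rt u v w : R u v -> R v w -> R u w by move=> uv; exact: joined_trans.
elim: p x => [|z p IH] x /=; first by move=> _; constructor 1; exact: connect0.
case/andP=> /hasP[g gF xzg] /IH {IH}; set y := last z p.
have [gf|gf] := eqVneq g f; last first.
  have Rxz : R x z.
    by apply: connect1; apply/hasP; exists g; rewrite // mem_filter gf.
  case=> [zy|/andP[za yb]|/andP[zb ya]].
  - by constructor 1; exact: (Rt _ _ _ Rxz zy).
  - by constructor 2; rewrite yb (Rt _ _ _ Rxz za).
  - by constructor 3; rewrite ya (Rt _ _ _ Rxz zb).
have R0 u : R u u by exact: connect0.
rewrite gf in xzg; case/orP: xzg => /eqP -> /=.
- case=> [zy|/andP[za yb]|/andP[_ ya]].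
  + by constructor 2; rewrite R0 Rsym.
  + by constructor 2; rewrite R0.
  + by constructor 1; rewrite Rsym.
- case=> [zy|/andP[za yb]|/andP[zb ya]].
  + by constructor 3; rewrite R0 Rsym.
  + by constructor 1; rewrite Rsym.
  + by constructor 3; rewrite R0.
Qed.

Lemma can_replaceE ends op e :
  can_replace ends op e =
  let R := joined ends (op_rest op) in
  let ab := ends (op_edge op) in
  (R (ends e).1 ab.1 && R (ends e).2 ab.2)
  || (R (ends e).1 ab.2 && R (ends e).2 ab.1).
Proof. by rewrite /can_replace; case: (ends _) (ends e) => a b [x y]. Qed.

(** If every path between the endpoints of [e] crosses the removed edge, the endpoints lie on its
    two sides, which is exactly suitability. *)
Lemma ends_joined_split ends F op e :
  [seq f <- F | f != op_edge op] = op_rest op ->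
  ~~ can_replace ends op e -> ends_joined ends F e ->
  ends_joined ends (op_rest op) e.
Proof.
rewrite can_replaceE negb_or /= => defR /andP[nab nba] /(joined_remove (op_edge op)).
rewrite defR; case=> // H; first by rewrite H in nab.
by rewrite H in nba.
Qed.

(** A path through the removed edge is rerouted through [r], since [r] joins again the two endpoints
    of that edge. *)
Lemma ends_joined_replace ends F op r e :
  [seq f <- F | f != op_edge op] = op_rest op ->
  can_replace ends op r -> ends_joined ends F e ->
  ends_joined ends (r :: op_rest op) e.
Proof.
rewrite can_replaceE /= => defR rep /(joined_remove (op_edge op)); rewrite defR.
rewrite /ends_joined.
set R := joined ends (op_rest op); set R' := joined ends (r :: _).
have RR' x y : R x y -> R' x y.
  by apply: joined_sub => f fR; rewrite inE fR orbT.
have Rsym u v : R' u v = R' v u by exact: joined_sym.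
have Rt u v w : R' u v -> R' v w -> R' u w by move=> uv; exact: joined_trans.
have Rr : R' (ends r).1 (ends r).2 by apply: joined_edge; rewrite mem_head.
have Rab : R' (ends (op_edge op)).1 (ends (op_edge op)).2.
  case/orP: rep => /andP[/RR' r1 /RR' r2].
    by apply: (Rt _ _ _ _ r2); apply: (Rt _ _ _ _ Rr); rewrite Rsym.
  by rewrite Rsym; apply: (Rt _ _ _ _ r2); apply: (Rt _ _ _ _ Rr); rewrite Rsym.
case=> [/RR' //|/andP[/RR' xa /RR' yb]|/andP[/RR' xb /RR' ya]].
  by apply: (Rt _ _ _ xa); apply: (Rt _ _ _ Rab); rewrite Rsym.
by apply: (Rt _ _ _ xb); rewrite Rsym; apply: (Rt _ _ _ ya).
Qed.

End ForestConnectivity.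

(** * Bounding the number of owners of a copy *)

Section Tokens.
Context {K : eqType}.
Implicit Types (w : pred K) (n : nat).

(** A cardinality bound phrased with duplicate-free lists, because the keys come from a type that
    may be infinite. *)
Definition at_most w n := forall s : seq K, uniq s -> all w s -> size s <= n.

Lemma at_most_sub w w' n : {subset w' <= w} -> at_most w n -> at_most w' n.
Proof. by move=> sw wn s us /(sub_all sw); apply: wn. Qed.

Lemma at_most_add w w' k n :
  (forall x, x != k -> w' x -> w x) -> at_most w n -> at_most w' n.+1.
Proof.
move=> sw wn s us w's.
have le1 : size s <= (size (rem k s)).+1.
  have [ks|nks] := boolP (k \in s); last by rewrite rem_id.
  by rewrite size_rem // leqSpred.
apply: leq_trans le1 _; rewrite ltnS; apply: wn; first exact: rem_uniq.
apply/allP => x; rewrite rem_filter // mem_filter => /andP[/= xk xs].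
by apply: sw => //; apply: (allP w's).
Qed.

Lemma at_most_del w w' k n :
  w k -> (forall x, w' x -> w x && (x != k)) -> at_most w n -> at_most w' n.-1.
Proof.
move=> wk sw wn s us w's.
have: size (k :: s) <= n.
  apply: wn => /=.
    by rewrite us andbT; apply/negP => /(allP w's) /sw; rewrite eqxx andbF.
  by rewrite wk; apply: sub_all w's => x /sw /andP[].
by case: n {wn}.
Qed.

Lemma at_most_gt0 w k n : w k -> at_most w n -> 0 < n.
Proof. by move=> wk /(_ [:: k]) /= /(_ isT); rewrite wk; apply. Qed.

(** Ownership passes from [k] to [k']: a deletion followed by an addition, with [n] positive because
    [k] satisfies [w]. *)
Lemma at_most_move w w' k k' n :
  w k -> (forall x, x != k' -> w' x -> w x && (x != k)) ->
  at_most w n -> at_most w' n.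
Proof.
move=> wk sw wn; rewrite -(prednK (at_most_gt0 wk wn)).
apply: (at_most_add (w := fun x => w' x && (x != k')) (k := k')) => [x ->-> //|].
by apply: at_most_del wn => [|x /andP[w'x xk']]; [exact: wk | exact: sw].
Qed.

End Tokens.

(** * What a program point reveals about its thread *)

Section ProgramCounters.
Context {E : Type}.
Implicit Type p : pc E.

(* The edge of which the thread at [p] owns a copy in the multiset. *)
Definition held p : option E :=
  match p with
  | AddReadOp e | AddOffer e _ | AddWonDelete e | AddReadSlot e _
  | AddLateDelete e | AddRetest e | AddRestartDelete e | AddMark e
  | AddAidedDelete e | BAddMarkNonSpanning e | RemDelete e
  | BRemAidMark _ _ e | BRemAidDelete _ _ e | BRemUseDelete _ e => Some e
  | _ => None
  end.

(* The edge that the thread at [p] can mark NON_SPANNING without reading      *)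
(* [remove_op] again.                                                         *)
Definition committed p : option E :=
  match p with AddRetest e | AddMark e => Some e | _ => None end.

Definition critical p : bool :=
  match p with
  | BAddReadStatus _ | BAddTest _ | BAddInsert _ | BAddMarkNonSpanning _
  | BAddLink _ | BAddMarkSpanning _ | BAddUnlock _
  | BRemReadStatus _ | BRemPublish _ | BRemScanStart _ | BRemScan _ _
  | BRemVisit _ _ _ | BRemClose _ _ _ _ | BRemClaim _ _ _ _
  | BRemAidTest _ _ _ | BRemAidInsert _ _ _ | BRemAidMark _ _ _
  | BRemAidDelete _ _ _ | BRemFinish _ | BRemUse _ _ | BRemUseMark _ _ _
  | BRemUseDelete _ _ | BRemUpdate _ _ | BRemMark _ | BRemClear _
  | BRemUnlock => true
  | _ => false
  end.

Definition own_op p : option (descriptor E) :=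
  match p with
  | BRemScanStart op | BRemScan op _ | BRemVisit op _ _ | BRemClose op _ _ _
  | BRemClaim op _ _ _ | BRemAidTest op _ _ | BRemAidInsert op _ _
  | BRemAidMark op _ _ | BRemAidDelete op _ _ | BRemFinish op | BRemUse op _
  | BRemUseMark op _ _ | BRemUseDelete op _ | BRemUpdate op _ | BRemMark op
  | BRemClear op => Some op
  | _ => None
  end.

Definition forest_updated p : bool :=
  match p with BRemMark _ | BRemClear _ => true | _ => false end.

(** [BRemVisit] is left out although a failed claim returns to it with a closed slot: it is also
    reached with the slot still open. *)
Definition slot_closed p : bool :=
  match p with
  | BRemClaim _ _ _ _ | BRemUse _ _ | BRemUseMark _ _ _ | BRemUseDelete _ _
  | BRemUpdate _ _ | BRemMark _ | BRemClear _ => true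
  | _ => false
  end.

(* The edges that a removal which has not found a replacement may still claim. *)
Definition unseen p : option (seq E) :=
  match p with
  | BRemScan _ todo | BRemAidTest _ todo _ | BRemAidInsert _ todo _
  | BRemAidMark _ todo _ | BRemAidDelete _ todo _ => Some todo
  | BRemVisit _ todo r | BRemClose _ todo r _ | BRemClaim _ todo r _ =>
      Some (r :: todo)
  | BRemFinish _ | BRemUpdate _ None => Some [::]
  | _ => None
  end.

Definition non_spanning (st : edge_status) : bool :=
  if st is NON_SPANNING then true else false.

End ProgramCounters.

(** * The inductive invariant *)

Section Invariant.
Context {V : finType} {E T : eqType} (ends : E -> V * V).
Implicit Types (m : shared E T) (op : descriptor E) (e r : E) (t : T) (p : pc E)
  (P : T -> pc E).

(** The key [None] is the record itself, which owns one copy while it is NON_SPANNING. *)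
Definition token m P e (k : option T) : bool :=
  if k is Some t then held (P t) == Some e else non_spanning (status_of m e).

(** These are the edges endangered by a split. INITIAL is required in the second case because
    otherwise the compare-and-set of the adder fails. *)
Definition pending m P e : Prop :=
  status_of m e = NON_SPANNING \/
  status_of m e = INITIAL /\ exists t, committed (P t) = Some e.

Definition offered m op : bool :=
  if replacement m (op_id op) is Installed _ then true else false.

Definition covered m P op (l : seq E) : Prop :=
  offered m op \/
  forall e, pending m P e -> can_replace ends op e -> e \in l.

(** The descriptor may be stale, but then its slot is [Done], so that an offer to it fails. *)
Definition offer_valid m e op : Prop :=
  op_id op < next_op m /\
  (remove_op m = Some op /\ can_replace ends op e
   \/ replacement m (op_id op) = Done).

(** At [AddMark] the retested connection is claimed only under INITIAL, the status for which the
    edge is pending and protected. *)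
Definition locals_ok m p : Prop :=
  match p with
  | AddOffer e op => offer_valid m e op
  | AddReadSlot e op => offer_valid m e op /\ replacement m (op_id op) <> Null
  | AddMark e => status_of m e = INITIAL -> ends_joined ends (forest m) e
  | BAddInsert e | BAddMarkNonSpanning e => ends_joined ends (forest m) e
  | BRemAidTest op _ r => ~~ can_replace ends op r
  | BRemAidInsert op _ r | BRemAidMark op _ r =>
      ~~ can_replace ends op r /\ ends_joined ends (forest m) r
  | BRemClose op _ r _ | BRemClaim op _ r _ | BRemUse op r | BRemUseMark op r _
  | BRemUseDelete op r | BRemUpdate op (Some r) => can_replace ends op r
  | _ => True
  end.

Record thread_ok m t p : Prop := ThreadOk {
  thread_lock : critical p -> Defs.lock m = Some t /\ remove_op m = own_op p;
  thread_rest : forall op, own_op p = Some op -> ~~ forest_updated p ->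
    [seq f <- forest m | f != op_edge op] = op_rest op;
  thread_slot : forall op, own_op p = Some op -> slot_closed p ->
    replacement m (op_id op) = Done;
  thread_locals : locals_ok m p
}.

Record invariant m P : Prop := Invariant {
  inv_joined : forall e, status_of m e = NON_SPANNING ->
    ends_joined ends (forest m) e;
  inv_unlocked : Defs.lock m = None -> remove_op m = None;
  inv_op_id : forall op, remove_op m = Some op -> op_id op < next_op m;
  inv_offer : forall op x, remove_op m = Some op ->
    replacement m (op_id op) = Installed x -> can_replace ends op x;
  inv_thread : forall t, thread_ok m t (P t);
  inv_covered : forall t op l, own_op (P t) = Some op ->
    unseen (P t) = Some l -> covered m P op l;
  inv_token : forall e,
    at_most (token m P e) (count_mem e (non_spanning_edges m))
}.

(* A call of an operation is treated as one more step of the thread. *)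
Variant local_step t : pc E -> shared E T -> pc E -> shared E T -> Prop :=
| local_thread_step p m p' m' of thread_step ends t p m p' m' :
    local_step t p m p' m'
| local_call_add e m : local_step t Idle m (AddTest e) m
| local_call_remove e m : local_step t Idle m (RemReadStatus e) m.

(** * Ownership of copies along a step *)

Ltac step_cases st :=
  destruct st as [? ? ? ? st | ? ? | ? ?]; [destruct st as [st | st | st | st];
    destruct st | |]; simpl in *.

(** [token_give] models marking an edge NON_SPANNING, where the copy of the thread passes to the
    record; [token_take] models removing or claiming such an edge, where it passes back. *)
Variant token_effect p m p' m' : Prop :=
| token_keep of non_spanning_edges m' = non_spanning_edges m
    & (forall e, non_spanning (status_of m' e) -> non_spanning (status_of m e))
    & (held p' = None \/ held p' = held p)
| token_insert x of non_spanning_edges m' = x :: non_spanning_edges m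
    & status_of m' = status_of m & held p' = Some x
| token_delete x of non_spanning_edges m' = rem x (non_spanning_edges m)
    & status_of m' = status_of m & held p = Some x & held p' = None
| token_give x of non_spanning_edges m' = non_spanning_edges m
    & (forall e, e != x -> status_of m' e = status_of m e)
    & held p = Some x & held p' = None
| token_take x of non_spanning_edges m' = non_spanning_edges m
    & (forall e, e != x -> status_of m' e = status_of m e)
    & non_spanning (status_of m x) & ~~ non_spanning (status_of m' x)
    & held p' = Some x.

Lemma status_set m x st : status_of (set_status m x st) x = st.
Proof. by rewrite /= eqxx. Qed.

Lemma status_set_neq m x st e :
  e != x -> status_of (set_status m x st) e = status_of m e.
Proof. by move=> /= /negPf ->. Qed.

Lemma local_step_token t p m p' m' :
  local_step t p m p' m' -> token_effect p m p' m'.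
Proof.
have give p0 m0 x p1 st : held p0 = Some x -> held p1 = None ->
    token_effect p0 m0 p1 (set_status m0 x st).
  by move=> h0 h1; apply: token_give h0 h1 => // e; exact: status_set_neq.
have take p0 m0 x p1 st : status_of m0 x = NON_SPANNING -> ~~ non_spanning st ->
    held p1 = Some x -> token_effect p0 m0 p1 (set_status m0 x st).
  move=> nsx nst h1; apply: token_take h1 => //; first exact: status_set_neq.
    by rewrite nsx.
  by rewrite status_set.
have drop p0 m0 x p1 st : ~~ non_spanning st -> held p1 = None ->
    token_effect p0 m0 p1 (set_status m0 x st).
  move=> nst h1; apply: token_keep => //; last by left.
  by move=> e; have [->|/status_set_neq-> //] := eqVneq e x; rewrite status_set (negPf nst).
have claim p0 m0 x op st : status_of m0 x = st ->
    token_effect p0 m0 (after_claim op x st) (set_status m0 x SPANNING).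
  by case: st => H; [apply: drop | apply: drop | apply: take | apply: drop].
move=> st; step_cases st; try by [exact: give | exact: take | exact: drop | exact: claim
  | apply: token_keep; auto | apply: token_insert | apply: token_delete].
Qed.

(** Insertions and deletions change the owners and the multiplicity together; giving and taking swap
    the keys [Some t] and [None] at constant multiplicity. *)
Lemma token_step t m P p' m' :
  token_effect (P t) m p' m' ->
  (forall e, at_most (token m P e) (count_mem e (non_spanning_edges m))) ->
  forall e, at_most (token m' [eta P with t |-> p'] e)
                    (count_mem e (non_spanning_edges m')).
Proof.
move=> eff inv e; have {inv} := inv e.
have cnt_rem x (s : seq E) : x \in s ->
    count_mem e (rem x s) = count_mem e s - (x == e).
  by move=> xs; rewrite (permP (perm_to_rem xs)) /= addKn.
case: eff => [-> st h|x -> st h|x -> st h h'|x -> st h h'|x -> st nx nx' h].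
- apply: at_most_sub => -[u|] /=; last exact: st.
  rewrite unfold_in /=; case: (eqVneq u t) => [->|//].
  by case: h => ->.
- have [->|nxe] := eqVneq x e.
    rewrite /= eqxx add1n; apply: (at_most_add (k := Some t)) => -[u|] /=.
      by case: (eqVneq u t) => [->|//]; rewrite eqxx.
    by rewrite st.
  rewrite /= (negPf nxe) add0n; apply: at_most_sub => -[u|]; rewrite unfold_in /=.
    by case: (eqVneq u t) => // _; rewrite h /eq_op /= (negPf nxe).
  by rewrite st.
- have [xe|nxe] := eqVneq x e; last first.
    have -> : count_mem e (rem x (non_spanning_edges m))
              = count_mem e (non_spanning_edges m).
      have [xin|/rem_id-> //] := boolP (x \in non_spanning_edges m).
      by rewrite cnt_rem // (negPf nxe) subn0.
    apply: at_most_sub => -[u|]; rewrite unfold_in /= ?st //.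
    by case: (eqVneq u t) => // _; rewrite h'.
  subst x => H.
  (* The deleting thread owns a copy, so the edge is present and [rem] lowers its multiplicity by
     exactly one. *)
  have tok : token m P e (Some t) by rewrite /= h.
  have ein : e \in non_spanning_edges m.
    by rewrite -has_pred1 has_count; exact: at_most_gt0 tok H.
  rewrite cnt_rem // eqxx subn1; apply: at_most_del tok _ H => -[u|] /=.
    case: (eqVneq u t) => [->|ut]; first by rewrite h'.
    by move=> ->; apply: contraNneq ut => -[->].
  by rewrite st => ->.
- have [xe|nxe] := eqVneq e x; last first.
    apply: at_most_sub => -[u|]; rewrite unfold_in /= ?st //.
    by case: (eqVneq u t) => // _; rewrite h'.
  subst x; apply: (@at_most_move _ _ _ (Some t) None); first by rewrite /= h.
  move=> [u|] //= _; case: (eqVneq u t) => [->|ut]; first by rewrite h'.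
  by move=> ->; apply: contraNneq ut => -[->].
- have [xe|nxe] := eqVneq e x; last first.
    apply: at_most_sub => -[u|]; rewrite unfold_in /= ?st //.
    by case: (eqVneq u t) => // _; rewrite h /eq_op /= eq_sym (negPf nxe).
  subst x; apply: (@at_most_move _ _ _ None (Some t)) => // -[u|] /=.
    case: (eqVneq u t) => [->|ut]; first by rewrite eqxx.
    by move=> _ ->.
  by rewrite (negPf nx').
Qed.

(** A pending edge has an owner: its record, or the thread committed to it. *)
Lemma pending_mem m P e :
  (forall e, at_most (token m P e) (count_mem e (non_spanning_edges m))) ->
  pending m P e -> e \in non_spanning_edges m.
Proof.
move=> inv pe; rewrite -has_pred1 has_count.
case: pe => [ns|[_ [t ct]]].
  by apply: (at_most_gt0 (k := None)) (inv e); rewrite /= ns.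
apply: (at_most_gt0 (k := Some t)) (inv e) => /=.
by case: (P t) ct => // ? [->].
Qed.

(** * Effect of one step on the lock, the slots, the forest and the statuses *)

Lemma local_step_frame t p m p' m' :
  local_step t p m p' m' -> ~~ critical p -> Defs.lock m <> None ->
  [/\ forest m' = forest m, remove_op m' = remove_op m & Defs.lock m' = Defs.lock m].
(* Outside the critical section only an acquisition of the lock touches these fields, and it is
   blocked while the lock is held. *)
Proof. by move=> st ncrit nlock; step_cases st. Qed.

Lemma local_step_next_op t p m p' m' :
  local_step t p m p' m' -> next_op m <= next_op m'.
Proof. by move=> st; step_cases st. Qed.

Lemma local_step_done t p m p' m' i :
  local_step t p m p' m' -> i < next_op m ->
  replacement m i = Done -> replacement m' i = Done.
Proof.
move=> st lti di; step_cases st => //; case: eqVneq => // Ei; subst i; try congruence.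
by rewrite ltnn in lti.
Qed.

Lemma local_step_not_null t p m p' m' i :
  local_step t p m p' m' -> i < next_op m ->
  replacement m i <> Null -> replacement m' i <> Null.
Proof.
move=> st lti ni; step_cases st => //; case: eqVneq => // Ei; subst i.
by rewrite ltnn in lti.
Qed.

(** A publisher finds no descriptor to overwrite, since it holds the lock; [BRemClear] withdraws one
    only after its slot is [Done]. *)
Lemma local_step_op t p m p' m' op :
  local_step t p m p' m' -> thread_ok m t p -> remove_op m = Some op ->
  remove_op m' = Some op \/ replacement m' (op_id op) = Done.
Proof.
move=> st tok rop; step_cases st; try by left.
  by case: (thread_lock tok isT) => _; rewrite rop.
right; case: (thread_lock tok isT) => _; rewrite rop => -[->].
exact: (thread_slot tok erefl isT).
Qed.

Lemma local_step_initial t p m p' m' e :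
  local_step t p m p' m' -> status_of m' e = INITIAL -> status_of m e = INITIAL.
Proof. by move=> st init; step_cases st => //; move: init; case: ifP. Qed.

(** Three steps change the forest: a link enlarges it, a replacement reconnects its two trees, and a
    split is handled by coverage with nothing left unseen. *)
Lemma local_step_joined t p m p' m' P e :
  local_step t p m p' m' -> thread_ok m t p ->
  (forall op, p = BRemUpdate op None -> covered m P op [::]) ->
  pending m P e -> ends_joined ends (forest m) e -> ends_joined ends (forest m') e.
Proof.
move=> st tok cov pe je; step_cases st => //.
- by apply: joined_sub je => f fF; rewrite inE fF orbT.
- rewrite (thread_rest tok erefl isT).
  exact: ends_joined_replace (thread_rest tok erefl isT) (thread_locals tok) je.
- rewrite (thread_rest tok erefl isT).
  apply: ends_joined_split (thread_rest tok erefl isT) _ je.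
  case: (cov _ erefl) => [|{}cov]; first by rewrite /offered (thread_slot tok erefl isT).
  by apply/negP => /(cov _ pe).
Qed.

(** Each of the three marking points carries the connection tested earlier in [locals_ok]. *)
Lemma local_step_non_spanning t p m p' m' e :
  local_step t p m p' m' -> thread_ok m t p -> status_of m' e = NON_SPANNING ->
  status_of m e = NON_SPANNING \/ ends_joined ends (forest m') e.
Proof.
move=> st tok nse; step_cases st; try by left.
all: move: nse; case: eqVneq => [-> // _ | _ nse]; last (by left); right.
- exact: (thread_locals tok).
- exact: (thread_locals tok).
- by case: (thread_locals tok).
Qed.

Lemma local_step_unlocked t p m p' m' :
  local_step t p m p' m' -> thread_ok m t p ->
  (Defs.lock m = None -> remove_op m = None) ->
  Defs.lock m' = None -> remove_op m' = None.
Proof.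
move=> st tok unl nlock; step_cases st; auto.
- by case: (thread_lock tok isT).
- by case: (thread_lock tok isT); rewrite nlock.
- by case: (thread_lock tok isT).
Qed.

Lemma local_step_op_id t p m p' m' :
  local_step t p m p' m' ->
  (forall op, remove_op m = Some op -> op_id op < next_op m) ->
  forall op, remove_op m' = Some op -> op_id op < next_op m'.
Proof.
by move=> st ids op rop; step_cases st; try exact: ids rop; case: rop => // <- /=.
Qed.

Lemma local_step_offer t p m p' m' :
  local_step t p m p' m' -> thread_ok m t p ->
  (forall op x, remove_op m = Some op ->
    replacement m (op_id op) = Installed x -> can_replace ends op x) ->
  forall op x, remove_op m' = Some op ->
    replacement m' (op_id op) = Installed x -> can_replace ends op x.
Proof.
move=> st tok off op' x rop slot; step_cases st => //; try exact: off rop slot.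
- move: slot; case: eqVneq => [Eid [<-]|_]; last exact: off.
  (* The slot was [Null], hence the descriptor is not stale and is the published one. *)
  case: (thread_locals tok) => _ [[]|]; last by rewrite H.
  by rewrite rop => -[->].
- by move: slot; case: rop => <- /=; rewrite eqxx.
all: by move: slot; case: eqVneq => // _; exact: off.
Qed.

(** * Stability of the local assertions and of coverage *)

Lemma thread_ok_other t p m p' m' P t' p2 :
  local_step t p m p' m' -> thread_ok m t p ->
  (forall op, p = BRemUpdate op None -> covered m P op [::]) ->
  (forall op, remove_op m = Some op -> op_id op < next_op m) ->
  P t' = p2 -> t' != t -> thread_ok m t' p2 -> thread_ok m' t' p2.
Proof.
move=> st tok cov ids Ep2 ntt' [lck rest slot loc].
(* Mutual exclusion: if [t'] is in its critical section, the moving thread is not. *)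
have frame : critical p2 -> [/\ forest m' = forest m, remove_op m' = remove_op m
    & Defs.lock m' = Defs.lock m].
  move=> /lck[lockt' _]; apply: (local_step_frame st); last by rewrite lockt'.
  apply/negP => /(thread_lock tok)[]; rewrite lockt' => -[Ett'].
  by rewrite Ett' eqxx in ntt'.
have crit op : own_op p2 = Some op -> critical p2 by case: (p2).
split.
- by move=> cr; case: (frame cr) => _ -> ->; exact: lck.
- by move=> op Eop; case: (frame (crit _ Eop)) => -> _ _; exact: rest.
- move=> op Eop cl; apply: (local_step_done st); last exact: slot.
  by apply: ids; case: (lck (crit _ Eop)) => _ ->.
have offv e op : offer_valid m e op -> offer_valid m' e op.
  case=> lti H; split; first exact: leq_trans lti (local_step_next_op st).
  case: H => [[rop rep]|dn]; last by right; exact: (local_step_done st).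
  by case: (local_step_op st tok rop); [left | right].
case: p2 Ep2 {lck rest slot crit} loc frame => //=.
- by move=> e op _ /offv.
- move=> e op _ [ov nn] _; split; first exact: offv.
  by apply: (local_step_not_null st) nn; case: ov.
(* An adder at [AddMark] holds no lock; its retest stays valid because its edge is pending, so that
   no split separates its endpoints. *)
- move=> e Ep2 je _ ini; have ini0 := local_step_initial st ini.
  apply: (local_step_joined st tok cov); last exact: je.
  by right; split=> //; exists t'; rewrite Ep2.
all: by intros; case: frame => // -> _ _.
Qed.

Lemma after_claim_ok t p m op r st :
  thread_ok m t p -> own_op p = Some op ->
  [&& critical p, ~~ forest_updated p & slot_closed p] -> can_replace ends op r ->
  thread_ok (set_status m r SPANNING) t (after_claim op r st).
Proof.
move=> [lck rest slot _] Eop /and3P[/lck[lockt rop] nu cl] rep.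
rewrite Eop in rop; have {}rest := rest _ Eop nu; have {}slot := slot _ Eop cl.
by case: st; split=> //= op' [<-].
Qed.

Lemma thread_ok_own t p m p' m' :
  local_step t p m p' m' -> thread_ok m t p ->
  (Defs.lock m = None -> remove_op m = None) ->
  (forall op, remove_op m = Some op -> op_id op < next_op m) ->
  (forall op x, remove_op m = Some op ->
    replacement m (op_id op) = Installed x -> can_replace ends op x) ->
  thread_ok m' t p'.
Proof.
move=> st tok unl ids off; have [lck rest slot loc] := tok.
step_cases st; try exact: (after_claim_ok _ tok erefl isT loc).
all: split=> //=; try exact: lck.
all: try by move=> op' [<-] _; exact: (rest _ erefl isT).
all: try by move=> op' [<-] _; exact: (slot _ erefl isT).
all: try by move=> op' [<-] _; rewrite eqxx.
all: try by move=> _; split=> //; exact: unl.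
all: try by move=> _; split=> //; case: (lck isT).
- by split; [exact: ids | left].
- by move=> op [<-].
all: by apply: off => //; case: (lck isT).
Qed.

Lemma pending_step t m P p' m' op e :
  local_step t (P t) m p' m' -> thread_ok m t (P t) -> remove_op m = Some op ->
  pending m' [eta P with t |-> p'] e -> can_replace ends op e ->
  pending m P e \/ offered m' op.
Proof.
move=> st tok rop pe rep.
have {pe} : [\/ status_of m' e = NON_SPANNING,
     status_of m' e = INITIAL /\ committed p' = Some e | pending m P e].
  case: pe => [ns|[ini [u]]] /=; first by constructor 1.
  case: eqVneq => [_ cp|_ cp]; [by constructor 2 | constructor 3; right].
  by split; [exact: (local_step_initial st) | exists u].
have old p0 : P t = p0 -> status_of m e = INITIAL -> committed p0 = Some e ->
    pending m P e.
  by move=> Ep ini cp; right; split=> //; exists t; rewrite Ep.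
move: (P t) (old _ erefl) st tok => p {}old st tok.
case=> [ns|[ini cp]|]; last by left.
{ have pe : status_of m e = NON_SPANNING -> pending m P e by left.
  step_cases st; try by left; exact: pe.
  all: move: ns; case: eqVneq => [Ee // _|_ ns]; last (by left; exact: pe); subst e.
  - by left; exact: old.
  - by case: (thread_lock tok isT); rewrite rop.
  - case: (thread_lock tok isT) => _; rewrite rop => -[Eop].
    by case: (thread_locals tok); rewrite -Eop rep. }
step_cases st => //; try congruence.
all: try by left; exact: old.
- have Eop : op0 = op by congruence.
  by case: cp H0 => ->; rewrite Eop rep.
(* The slot is neither [Null], by the local assertion, nor [Done], by the test just made. *)
- case: (thread_locals tok) => -[_ [[rop0 _]|//]] nn; right.
  have Eop : op = op0 by congruence.
  rewrite /offered Eop.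
  by case: (replacement m (op_id op0)) H nn.
- by destruct st.
- by destruct st.
Qed.

Lemma covered_step t m P p' m' op l :
  local_step t (P t) m p' m' -> thread_ok m t (P t) -> remove_op m = Some op ->
  (offered m op -> offered m' op) ->
  covered m P op l -> covered m' [eta P with t |-> p'] op l.
Proof.
move=> st tok rop off [/off|cov]; first by left.
have [?|no] := boolP (offered m' op); [by left | right=> e pe rep].
by case: (pending_step st tok rop pe rep) => [/cov/(_ rep)//|o]; rewrite o in no.
Qed.

Lemma local_step_offered t p m p' m' op :
  local_step t p m p' m' -> ~~ critical p -> op_id op < next_op m ->
  offered m op -> offered m' op.
Proof.
rewrite /offered => st ncrit lti o; step_cases st => //.
by case: eqVneq.
Qed.

Lemma covered_own t m P p' m' op l :
  local_step t (P t) m p' m' -> thread_ok m t (P t) ->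
  (forall op l, own_op (P t) = Some op -> unseen (P t) = Some l ->
    covered m P op l) ->
  (forall e, at_most (token m' [eta P with t |-> p'] e)
                     (count_mem e (non_spanning_edges m'))) ->
  own_op p' = Some op -> unseen p' = Some l ->
  covered m' [eta P with t |-> p'] op l.
Proof.
move=> st tok cov /pending_mem mem.
have own_crit p : own_op p <> None -> critical p by case: p.
have covm op0 l0 : own_op (P t) = Some op0 -> unseen (P t) = Some l0 ->
    (offered m op0 -> offered m' op0) -> covered m' [eta P with t |-> p'] op0 l0.
  move=> Eop El off; apply: (covered_step st tok _ off (cov _ _ Eop El)).
  by case: (thread_lock tok _) => [|_ ->]; first by apply: own_crit; rewrite Eop.
have covs op0 l1 l2 :
    (forall e, pending m' [eta P with t |-> p'] e -> can_replace ends op0 e ->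
       e \in l1 -> e \in l2) ->
    covered m' [eta P with t |-> p'] op0 l1 -> covered m' [eta P with t |-> p'] op0 l2.
  move=> sub [o|c]; [by left | right=> e pe rep].
  by apply: sub (c _ pe rep).
move: (P t) [eta P with t |-> p'] st tok covm covs mem {cov own_crit} => p Q st tok covm covs mem.
rewrite /offered in covm; step_cases st => //; (try by destruct st); move=> [<-] [<-].
all: try by apply: (covm _ _ erefl erefl).
(* At the start of the scan the list is the whole multiset, which contains every pending edge. *)
- by right=> e /mem.
- apply: covs (covm _ _ erefl erefl id) => e _ _ etodo.
  by rewrite inE mem_filter etodo andbT orbN.
(* A skipped edge is absent from the multiset, hence not pending. *)
- apply: covs (covm _ _ erefl erefl id) => e /mem eN _ etodo.
  by rewrite mem_filter etodo andbT; apply: contraNneq H => <-.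
- by left; rewrite /offered H.
- apply: covs (covm _ _ erefl erefl id) => e _ rep.
  by rewrite inE => /orP[/eqP Ee|//]; rewrite Ee (negPf H0) in rep.
- apply: covs (covm _ _ erefl erefl id) => e _ rep.
  by rewrite inE => /orP[/eqP Ee|//]; rewrite Ee (negPf H0) in rep.
- apply: covs (covm _ _ erefl erefl id) => e pe _.
  rewrite inE => /orP[/eqP Ee|//]; subst e.
  by case: pe => [|[]] ns; case: H; rewrite ns.
(* Closing a slot that holds no edge destroys no offer. *)
- by apply: (covm _ _ erefl erefl); case: H => ->.
- by apply: (covm _ _ erefl erefl); case: H => ->.
Qed.

(** * Induction over executions *)

Lemma invariant_step t m P p' m' :
  invariant m P -> local_step t (P t) m p' m' ->
  invariant m' [eta P with t |-> p'].
Proof.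
move=> [joined unl ids off thr cov tok] st; have thrt := thr t.
have cov0 op : P t = BRemUpdate op None -> covered m P op [::].
  by move=> Ep; apply: (cov t); rewrite Ep.
have {}tok := token_step (local_step_token st) tok.
split=> //.
- move=> e nse; case: (local_step_non_spanning st thrt nse) => // ns.
  by apply: (local_step_joined st thrt cov0); [left | exact: joined].
- exact: local_step_unlocked st thrt unl.
- exact: local_step_op_id st ids.
- exact: local_step_offer st thrt off.
- move=> u /=; case: eqVneq => [->|ut]; first exact: thread_ok_own st thrt unl ids off.
  exact: thread_ok_other st thrt cov0 ids erefl ut (thr u).
move=> u op l /=; case: eqVneq => [_|ut Eop El].
  by apply: covered_own st thrt _ tok => op0 l0; exact: cov.
have crit : critical (P u) by case: (P u) Eop.
have [lu ru] := thread_lock (thr u) crit; rewrite Eop in ru.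
apply: (covered_step st thrt ru) (cov _ _ _ Eop El).
(* The removal of [u] holds the lock, so the moving thread is outside its critical section and
   cannot close the slot. *)
apply: (local_step_offered st); last exact: ids.
apply/negP => /(thread_lock thrt)[]; rewrite lu => -[Eut].
by rewrite Eut eqxx in ut.
Qed.

Lemma reachable_invariant (c : config E T) :
  reachable ends c -> invariant (memory c) (pcs c).
Proof.
elim=> [|{}c c' _ inv st].
  (* Initially nobody owns a copy, so a list of owners is empty. *)
  split=> //= e s us; case: s us => //= -[t|] s //=.
case: st => [t e Et _ _|t e Et|t p' m' st] /=; apply: invariant_step inv _.
- by rewrite Et; constructor.
- by rewrite Et; constructor.
- by constructor.
Qed.

End Invariant.

Theorem theorem2 (V : finType) (E T : eqType) (ends : E -> V * V)
    (c : config E T) :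
  reachable ends c ->
  ~ exists e : E, status_of (memory c) e = NON_SPANNING
                  /\ ~~ ends_joined ends (forest (memory c)) e.
Proof.
move=> /reachable_invariant inv [e [ns /negP]]; apply.
exact: inv_joined inv e ns.
Qed.
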